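(* Let $n$ be a positive integer with $n\equiv 6 \pmod{10}$. Then there exists a configuration $(1,5)$ $GDD\left(n,2,6;2n,n-1\right)$.
   Context: A $GDD(n,2,6;\lambda_1,\lambda_2)$ is a finite collection (repetitions allowed) of $6$-element subsets, called blocks, of a $2n$-element set $X$ partitioned into two groups of size $n$, such that every point lies in the same number $r$ of blocks, any two distinct points of the same group lie together in exactly $\lambda_1$ blocks, and any two points from different groups lie together in exactly $\lambda_2$ blocks. It has configuration $(1,5)$ if every block has exactly $1$ point in one of the two groups and $5$ points in the other (which group contains the single point may depend on the block). *)

(* Defs.v *)
From mathcomp Require Import all_boot.

Set Implicit Arguments.
Unset Strict Implicit.
Unset Printing Implicit Defensive.

(* Group divisible design GDD(n, m, k; lambda1, lambda2) on the point set T.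
   P is the set of groups. The blocks form a multiset, represented by a
   sequence B in which a block may be repeated; the order is irrelevant, since
   only multiplicities are counted below. *)
Record is_GDD (n m k lambda1 lambda2 : nat)
    (T : finType) (P : {set {set T}}) (B : seq {set T}) : Prop := IsGDD {
  gdd_card_points : #|T| = m * n;
  gdd_partition : partition P [set: T];
  gdd_num_groups : #|P| = m;
  gdd_card_group : forall G : {set T}, G \in P -> #|G| = n;
  gdd_card_block : forall b : {set T}, b \in B -> #|b| = k;
  gdd_replication :
    exists r : nat, forall x : T, count (fun b : {set T} => x \in b) B = r;
  gdd_same_group : forall (G : {set T}) (x y : T),
    G \in P -> x \in G -> y \in G -> x != y ->
    count (fun b : {set T} => (x \in b) && (y \in b)) B = lambda1;
  gdd_diff_group : forall (G H : {set T}) (x y : T),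
    G \in P -> H \in P -> G != H -> x \in G -> y \in H ->
    count (fun b : {set T} => (x \in b) && (y \in b)) B = lambda2
}.

(* Meaningful for two groups: each block has s points in one group and t in the
   other, and which group has s points may depend on the block. *)
Definition has_configuration (s t : nat)
    (T : finType) (P : {set {set T}}) (B : seq {set T}) : Prop :=
  forall b : {set T}, b \in B ->
  exists G H : {set T},
    [/\ G \in P, H \in P, G != H, #|b :&: G| = s & #|b :&: H| = t].

(* Main.v *)
Require Import Defs.
From mathcomp Require Import all_boot all_algebra.
From mathcomp Require Import zify.

Set Implicit Arguments.
Unset Strict Implicit.
Unset Printing Implicit Defensive.

Import GRing.Theory.

(* Write n = 5 m + 1 with m = 2 k + 1, and take as points of each group
   V x Z_5 plus a point at infinity, where V is cyclic of order m; the fibre of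
   x in V is {x} x Z_5.  Let Q be a set of representatives of the nonzero
   elements of V up to sign, so #|Q| = k.  The design is the union of three
   families of blocks, each block being a single point in one group and five
   points in the other:
   - for each x, a copy of the design for n = 6 on the fibre of x and infinity;
   - for each x and each a in Q, 220 blocks on the fibres of x, x - a, x + a and
     infinity, found by computer;
   - for each x, all a != b in Q and each sign, 25 + 25 blocks whose five points
     lie on the fibres of x, x + a, x - a, x + b, x - b, arranged as the lines of
     an affine plane of order 5, and whose single point is on the fibre of
     x + c or x - c, where c = op a b for an idempotent quasigroup op on Q.
   Since V has odd order, the number of times a given pair of distinct fibres
   occurs is the same for all pairs: the third family contributes
   20 (k - 1) = 10 m - 30 to lambda_1, so that the second one, a fixed finite
   object, only has to contribute 32 (and 20 inside the fibres).  Idempotent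
   quasigroups exist in all orders k != 2; the remaining case n = 26 comes from a
   cyclic difference family. *)

(** * Pair counts in lists of blocks, and the passage to designs *)

Definition incidence (X : eqType) (B : seq (seq X)) (p q : X) : nat :=
  sumn [seq count_mem p b * count_mem q b | b <- B].

Definition one_five (X : eqType) (b : seq (bool * X)) : bool :=
  [&& uniq b, size b == 6 & count (fun p => p.1) b \in [:: 1; 5]].

Lemma incidenceE (X : eqType) (B : seq (seq X)) p q :
  incidence B p q = \sum_(b <- B) count_mem p b * count_mem q b.
Proof. by rewrite /incidence sumnE big_map. Qed.

Lemma incidence_cat (X : eqType) (B1 B2 : seq (seq X)) p q :
  incidence (B1 ++ B2) p q = incidence B1 p q + incidence B2 p q.
Proof. by rewrite /incidence map_cat sumn_cat. Qed.

Lemma incidenceC (X : eqType) (B : seq (seq X)) p q :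
  incidence B p q = incidence B q p.
Proof. by rewrite !incidenceE; apply: eq_bigr => b _; rewrite mulnC. Qed.

(** Without duplicates all multiplicities are 0 or 1. The definition multiplies multiplicities
    because these add up over the positions of a symbolic block. *)
Lemma incidence_uniq (X : eqType) (B : seq (seq X)) p q :
  all uniq B ->
  incidence B p q = count (fun b => (p \in b) && (q \in b)) B.
Proof.
elim: B => //= b B IH /andP[ub /IH {}IH]; rewrite -IH /incidence /=.
by rewrite !count_uniq_mem //; case: (p \in b); case: (q \in b).
Qed.

Section Assembly.
Variables (A : finType) (B : seq (seq (bool * A))).
Hypothesis n_gt0 : 0 < #|A|.
Hypothesis shapeB : all (@one_five A) B.
Hypothesis same : forall g z z', z != z' ->
  incidence B (g, z) (g, z') = 2 * #|A|.
Hypothesis diff : forall z z',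
  incidence B (false, z) (true, z') = #|A| - 1.

Let X := (bool * A)%type.
Let grp (g : bool) : {set X} := [set p | p.1 == g].
Let toset (b : seq X) : {set X} := [set p in b].

Lemma uniqB : all uniq B.
Proof. by apply: sub_all shapeB => b /and3P[]. Qed.

Lemma pair_count p q : count (fun b : {set X} => (p \in b) && (q \in b))
    (map toset B) = incidence B p q.
Proof.
rewrite incidence_uniq ?uniqB // count_map; apply: eq_count => b /=.
by rewrite !inE.
Qed.

Lemma pair_val p q : p != q ->
  incidence B p q = if p.1 == q.1 then 2 * #|A| else #|A| - 1.
Proof.
case: p q => [g z] [g' z'] /= npq; case: eqP => [e|].
  by rewrite -e same //; apply: contraNneq npq => ->; rewrite e.
by case: g g' npq => [] [] _ // _; rewrite 1?incidenceC diff.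
Qed.

(* Double counting of the pairs (q, b) with q != p and both p and q in b. *)
Lemma replication p : count (fun b : {set X} => p \in b) (map toset B) * 5
  = (#|A| - 1) * (2 * #|A|) + #|A| * (#|A| - 1).
Proof.
have -> : count (fun b : {set X} => p \in b) (map toset B) =
          \sum_(b <- B) (p \in b).
  rewrite count_map -sumn_count sumnE big_map; apply: eq_bigr => b _ /=.
  by rewrite inE.
transitivity (\sum_(q : X | q != p) incidence B p q).
  rewrite (eq_bigr _ (fun q _ => incidenceE B p q)).
  rewrite exchange_big big_distrl /= !big_seq; apply: eq_bigr => b bB.
  have /and3P[ub /eqP sb _] := allP shapeB b bB.
  rewrite -big_distrr /= count_uniq_mem //; case: (boolP (p \in b)) => // pb.
  congr (_ * _); under eq_bigr => q _ do rewrite count_uniq_mem //.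
  rewrite -big_mkcondr sum1_card; apply/eqP.
  rewrite -(eqn_add2l 1) add1n -sb -(card_uniqP ub) (cardD1 p) pb add1n eqSS.
  exact/eqP/eq_card.
(* The other points split into #|A| - 1 in the group of [p] and #|A| in the opposite group. *)
rewrite (bigID (fun q : X => q.1 == p.1)) /=; congr (_ + _).
  under eq_bigr => q /andP[npq pq] do
    rewrite pair_val ?(eq_sym p) // (eq_sym p.1) pq.
  rewrite sum_nat_const; congr (_ * _).
  transitivity #|[pred z : A | z != p.2]|.
    rewrite -[RHS](card_imset _ (f := fun z => (p.1, z))); last by move=> z z' [].
    apply: eq_card => -[g z]; rewrite unfold_in /=.
    apply/andP/imsetP => [[npq /= /eqP e]|[z' /[!inE] ne [-> ->]]].
      by exists z; rewrite ?e // inE; apply: contraNneq npq => ->;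
         rewrite e; case: (p).
    by split=> //=; apply: contraNneq ne => <-.
  by have := cardC1 p.2; rewrite subn1 => <-; apply: eq_card => z; rewrite !inE.
under eq_bigr => q /andP[npq pq] do
  rewrite pair_val ?(eq_sym p) // (eq_sym p.1) (negbTE pq).
rewrite sum_nat_const; congr (_ * _).
rewrite -[RHS](card_imset _ (f := fun z => (~~ p.1, z))); last by move=> z z' [].
apply: eq_card => -[g z]; rewrite unfold_in /=.
apply/andP/imsetP => [[_ /= npq]|[z' _ [-> ->]]].
  by exists z => //; move: npq; case: g; case: (p.1).
by split=> /=; [apply/eqP; case: (p) => -[] | case: (p.1)].
Qed.

Lemma gdd_of_incidence :
  exists (T : finType) (P : {set {set T}}) (C : seq {set T}),
  is_GDD #|A| 2 6 (2 * #|A|) (#|A| - 1) P C /\ has_configuration 1 5 P C.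
Proof.
have [z0 _] : exists z0 : A, z0 \in A by apply/card_gt0P.
have grp_inj : injective grp.
  by move=> g g' /setP/(_ (g, z0)); rewrite !inE eqxx => /esym/eqP.
pose P := [set grp g | g in [set: bool]].
have grpP G : reflect (exists g, G = grp g) (G \in P).
  by apply: (iffP imsetP) => [[g _ ->]|[g ->]]; exists g.
have card_grp g : #|grp g| = #|A|.
  rewrite -[RHS](card_imset _ (f := fun z : A => (g, z))); last by move=> z z' [].
  apply: eq_card => -[g' z]; rewrite !inE /=.
  by apply/eqP/imsetP => [-> | [z' _ [-> _]]]; first by exists z.
exists X, P, (map toset B); split; last first.
  move=> _ /mapP[b bB ->]; have /and3P[ub /eqP sb cb] := allP shapeB b bB.
  have cI g : #|toset b :&: grp g| = count (fun p => p.1 == g) b.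
    rewrite -size_filter -(card_uniqP (filter_uniq _ ub)).
    by apply: eq_card => p; rewrite !inE mem_filter andbC.
  have ct : count (fun p => p.1 == true) b = count (fun p => p.1) b.
    by apply: eq_count => p; rewrite eqb_id.
  have cf : count (fun p => p.1 == false) b = 6 - count (fun p => p.1) b.
    rewrite -sb -(count_predC (fun p => p.1)) addKn.
    by apply: eq_count => p; rewrite eqbF_neg.
  have grpneq g : grp g != grp (~~ g).
    by apply/eqP => /grp_inj; case: (g).
  move: cb; rewrite !inE => /orP[] /eqP cb.
    exists (grp true), (grp false); rewrite !cI ct cf cb; split=> //;
      by [apply/grpP; eexists | apply: (grpneq true)].
  exists (grp false), (grp true); rewrite !cI ct cf cb; split=> //;
    by [apply/grpP; eexists | apply: (grpneq false)].
split.
- by rewrite card_prod card_bool.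
- apply/and3P; split.
  + rewrite eqEsubset subsetT; apply/subsetP => p _.
    by apply/bigcupP; exists (grp p.1); rewrite ?inE //; apply/grpP; eexists.
  + apply/trivIsetP => _ _ /grpP[g ->] /grpP[g' ->] ne.
    rewrite -setI_eq0; apply/eqP/setP => p; rewrite !inE.
    apply/negP => /andP[/eqP e /eqP e'].
    by rewrite -e -e' eqxx in ne.
  + by apply/negP => /grpP[g /setP/(_ (g, z0))]; rewrite !inE eqxx.
- by rewrite card_imset // cardsT card_bool.
- by move=> _ /grpP[g ->].
- move=> _ /mapP[b bB ->]; have /and3P[ub /eqP <- _] := allP shapeB b bB.
  by rewrite -(card_uniqP ub); apply: eq_card => p; rewrite !inE.
- exists (count (fun b : {set X} => (false, z0) \in b) (map toset B)) => x.
  (* Five times the replication number is a value that does not depend on the point. *)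
  by apply/eqP; rewrite -(@eqn_pmul2r 5) // !replication.
- move=> _ p q /grpP[g ->]; rewrite !inE => /eqP pg /eqP qg npq.
  by rewrite pair_count pair_val // pg qg eqxx.
- move=> _ _ p q /grpP[g ->] /grpP[g' ->] ne; rewrite !inE => /eqP pg /eqP qg.
  have npq : p.1 != q.1 by rewrite pg qg; apply: contraNneq ne => ->.
  rewrite pair_count pair_val ?(negbTE npq) //.
  by apply: contraNneq npq => ->.
Qed.
End Assembly.

(** * Symbolic blocks and their finite tables *)

Definition block (X : eqType) (g : bool) (y : X) (c : seq X) : seq (bool * X) :=
  (~~ g, y) :: [seq (g, z) | z <- c].

(* A symbolic block: Some (s, l) stands for the point with label l on the fibre
   at position s, and None for the point at infinity.  Instances are obtained by
   placing the positions in V. *)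
Definition pattern := seq (bool * option (nat * nat)).

(** Codes 0, ..., 5r - 1 run through [r] fibres of five points, and 5r is infinity. *)
Definition decode (r z : nat) : option (nat * nat) :=
  if z == 5 * r then None else Some (z %/ 5, z %% 5).

Definition grid (r t : nat) : seq (nat * nat) :=
  [seq (i, j) | i <- iota 0 r, j <- iota 0 t].

(* The case n = 6: the complement of c goes with the single point y iff c - y is
   in {0, 1, 2} modulo 6 on one side, and iff y - c is in {3, 4, 5} on the other,
   so that two points of different groups meet 3 + 3 - 1 times. *)
Definition fill_patterns : seq pattern :=
  [seq block g (decode 1 yc.1) [seq decode 1 z | z <- rem yc.2 (iota 0 6)]
  | g <- [:: false; true],
    yc <- [seq yc <- grid 6 6 | if g then 2 < (yc.1 + 6 - yc.2) %% 6
                                else (yc.2 + 6 - yc.1) %% 6 < 3]].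

(* The single point and the five other points of 22 base blocks, to be developed
   modulo 5; found by computer search so as to satisfy [triple_table]. *)
Definition triple_base : seq (nat * seq nat) :=
  [:: (5, [:: 0; 6; 8; 12; 15]); (2, [:: 1; 5; 10; 14; 15]);
      (7, [:: 3; 9; 10; 13; 15]); (13, [:: 0; 5; 9; 10; 15]);
      (14, [:: 0; 2; 5; 14; 15]); (15, [:: 1; 2; 8; 9; 13]);
      (4, [:: 4; 5; 9; 12; 14]); (14, [:: 0; 4; 8; 9; 14]);
      (1, [:: 3; 5; 7; 10; 13]); (4, [:: 3; 5; 6; 11; 12]);
      (2, [:: 3; 5; 8; 10; 12]); (11, [:: 1; 2; 5; 7; 11]);
      (14, [:: 2; 4; 8; 9; 10]); (12, [:: 0; 1; 5; 7; 14]);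
      (10, [:: 4; 7; 8; 11; 14]); (5, [:: 0; 1; 8; 12; 13]);
      (13, [:: 2; 7; 9; 10; 11]); (14, [:: 1; 3; 5; 9; 13]);
      (5, [:: 1; 2; 3; 5; 12]); (8, [:: 0; 3; 5; 11; 13]);
      (0, [:: 3; 4; 6; 11; 14]); (2, [:: 3; 7; 9; 10; 13])].

Definition shift (t : nat) : option (nat * nat) -> option (nat * nat) :=
  omap (fun sl => (sl.1, (sl.2 + t) %% 5)).

Definition triple_patterns : seq pattern :=
  [seq block g (shift ct.2 (decode 3 ct.1.1))
     [seq shift ct.2 (decode 3 z) | z <- ct.1.2]
  | g <- [:: false; true],
    ct <- [seq (c, t) | c <- triple_base, t <- iota 0 5]].

(* The lines of the affine plane of order 5: the slopes s = 0, ..., 4 give five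
   points, and the vertical direction gives the single point. *)
Definition transversal_patterns : seq pattern :=
  [seq block g (Some (5, ab.2))
     [seq Some (s, (ab.1 + ab.2 * s) %% 5) | s <- iota 0 5]
  | g <- [:: false; true], ab <- grid 5 5].

Definition good (r : nat) (b : pattern) : bool :=
  one_five b &&
  all (fun p => if p.2 is Some sl then (sl.1 < r) && (sl.2 < 5) else true) b.

Lemma good_patterns :
  [&& all (good 1) fill_patterns, all (good 3) triple_patterns
    & all (good 6) transversal_patterns].
Proof. by vm_compute. Qed.

Lemma lt5_ind (P : pred nat) : all P (iota 0 5) -> forall i, i < 5 -> P i.
Proof. by move=> /allP aP i i5; apply: aP; rewrite mem_iota. Qed.

(** A bounded check over lists, so that one [vm_compute] settles it. *)
Definition tabulated (P : bool -> nat -> nat -> bool) : bool :=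
  all (fun g => all (fun i => all (P g i) (iota 0 5)) (iota 0 5))
      [:: false; true].

Lemma tabulatedP (P : bool -> nat -> nat -> bool) :
  tabulated P -> forall g (i j : 'I_5), P g i j.
Proof.
move=> /allP aP g i j; have := aP g; rewrite !inE; case: g => /(_ isT);
  by move=> /lt5_ind/(_ _ (ltn_ord i))/lt5_ind/(_ _ (ltn_ord j)).
Qed.

Definition symbol (g : bool) (s i : nat) : bool * option (nat * nat) :=
  (g, Some (s, i)).

(** The values are 2n = 12 and n - 1 = 5 for n = 6. *)
Definition fill_table (g : bool) (i j : nat) : bool :=
  [&& (i != j) ==> (incidence fill_patterns (symbol g 0 i) (symbol g 0 j) == 12),
      incidence fill_patterns (symbol g 0 i) (symbol (~~ g) 0 j) == 5,
      incidence fill_patterns (g, None) (symbol g 0 j) == 12,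
      incidence fill_patterns (g, None) (symbol (~~ g) 0 j) == 5
    & incidence fill_patterns (g, None) (~~ g, None) == 5].

(** Positions 0, 1, 2 stand for x, x - a, x + a. The pairs (0,2), (1,0) differ by a, the pairs
    (2,0), (0,1) by - a, and (1,2), (2,1) by 2a and - 2a; the equalities make the counts insensitive
    to the sign of the difference. With n = 10k + 6, the targets are 32 = 2n - 20(k - 1) and 15 = n
    - 1 - 10(k - 1) across fibres, and 20k = 2n - 12 and 10k = n - 1 - 5 within them. *)
Definition triple_table (g : bool) (i j : nat) : bool :=
  let F h s t := incidence triple_patterns (symbol g s i) (symbol h t j) in
  let N h t := incidence triple_patterns (g, None) (symbol h t j) in
  [&& (i != j) ==> (F g 0 0 + F g 1 1 + F g 2 2 == 20),
      F (~~ g) 0 0 + F (~~ g) 1 1 + F (~~ g) 2 2 == 10,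
      all (fun h => [&& F h 0 2 + F h 1 0 == F h 2 0 + F h 0 1,
                        F h 1 2 == F h 2 1 &
                        F h 0 2 + F h 1 0 + F h 1 2 == if h == g then 32 else 15])
          [:: false; true],
      N g 0 + N g 1 + N g 2 == 20,
      N (~~ g) 0 + N (~~ g) 1 + N (~~ g) 2 == 10
    & incidence triple_patterns (g, None) (~~ g, None) == 0].

Definition transversal_table (g : bool) (i j : nat) : bool :=
  let F h s t := incidence transversal_patterns (symbol g s i) (symbol h t j) in
  [&& all (fun st => if st.1 != st.2 then F g st.1 st.2 == (st.1 < 5) && (st.2 < 5)
                     else (i != j) ==> (F g st.1 st.2 == 0)) (grid 6 6),
      all (fun st => F (~~ g) st.1 st.2 == (st.1 < 5) (+) (st.2 < 5)) (grid 6 6)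
    & all (fun p => incidence transversal_patterns (g, None) p == 0)
        ((~~ g, None) :: [seq symbol h s j | h <- [:: false; true], s <- iota 0 6])].

Lemma fill_tableP g (i j : 'I_5) : fill_table g i j.
Proof. by apply: tabulatedP; vm_compute. Qed.

Lemma triple_tableP g (i j : 'I_5) : triple_table g i j.
Proof. by apply: tabulatedP; vm_compute. Qed.

Lemma transversal_tableP g (i j : 'I_5) : transversal_table g i j.
Proof. by apply: tabulatedP; vm_compute. Qed.

(* Otherwise unification and simplification try to evaluate the tables. *)
#[global] Opaque incidence fill_patterns triple_patterns transversal_patterns.

(** * Placing symbolic blocks in V *)

Section Instances.
Variable V : finZmodType.
Implicit Types (u w x : V) (T : nat -> V) (g : bool) (i j : 'I_5).

Let point := (bool * option (V * 'I_5))%type.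

Definition place T (z : bool * option (nat * nat)) : point :=
  (z.1, omap (fun sl => (T sl.1, inord sl.2)) z.2).

Definition instances (I : eqType) (Ts : I -> nat -> V) (e : seq I)
    (L : seq pattern) : seq (seq point) :=
  [seq map (place (Ts k)) b | k <- e, b <- L].

Lemma count_place_inf T (b : pattern) g :
  count_mem (g, None) (map (place T) b) = count_mem (g, None) b.
Proof. by rewrite count_map; apply: eq_count => -[h [[s l]|]]. Qed.

(** [T] may send several positions to the same fibre, hence a sum over all positions placed at
    [u]. *)
Lemma count_place r T (b : pattern) g u i : good r b ->
  count_mem (g, Some (u, i)) (map (place T) b) =
  \sum_(s < r) (T s == u) * count_mem (symbol g s i) b.
Proof.
case/andP=> _; elim: b => [|z b IH] /=.
  by move=> _; rewrite big1 // => s _; rewrite muln0.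
case/andP=> hz /IH {}IH; rewrite IH; under [RHS]eq_bigr do rewrite mulnDr.
rewrite big_split /=; congr (_ + _).
case: z hz => h [[s l]|] /= hz; last first.
  rewrite big1 => [|s _]; last by rewrite /symbol xpair_eqE andbF muln0.
  by rewrite /place /= xpair_eqE andbF.
case/andP: hz => sr l5; rewrite (bigD1 (Ordinal sr)) //= big1 ?addn0.
  rewrite /place /symbol /= !xpair_eqE !(inj_eq Some_inj) !xpair_eqE eqxx /=.
  by rewrite -(inj_eq val_inj) /= inordK // andbCA mulnb.
move=> t; rewrite -(inj_eq val_inj) /= => ts.
by rewrite /symbol !xpair_eqE /= /eq_op /= xpair_eqE (eq_sym s) (negbTE ts) andbF muln0.
Qed.

Variables (I : eqType) (Ts : I -> nat -> V) (e : seq I).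

Lemma incidence_instances L p q :
  incidence (instances Ts e L) p q =
  \sum_(k <- e) incidence (map (map (place (Ts k))) L) p q.
Proof.
rewrite incidenceE big_allpairs_dep; apply: eq_bigr => k _.
by rewrite incidenceE big_map.
Qed.

Lemma incidence_inf_inf L g g' :
  incidence (instances Ts e L) (g, None) (g', None) =
  size e * incidence L (g, None) (g', None).
Proof.
rewrite incidence_instances (eq_bigr (fun=> incidence L (g, None) (g', None))).
  by rewrite big_const_seq count_predT iter_addn_0 mulnC.
move=> T _; rewrite !incidenceE big_map; apply: eq_bigr => b _.
by rewrite !count_place_inf.
Qed.

Lemma incidence_inf L r g g' w j : all (good r) L ->
  incidence (instances Ts e L) (g, None) (g', Some (w, j)) =
  \sum_(s < r) (\sum_(k <- e) (Ts k s == w)) *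
    incidence L (g, None) (symbol g' s j).
Proof.
move=> /allP gL; rewrite incidence_instances.
under [RHS]eq_bigr do rewrite big_distrl /=.
rewrite [RHS]exchange_big; apply: eq_bigr => k _.
rewrite incidenceE big_map big_seq.
under eq_bigr => b bL do
  rewrite count_place_inf (count_place _ _ _ _ (gL b bL)) big_distrr /=.
rewrite exchange_big; apply: eq_bigr => s _.
rewrite incidenceE big_distrr /= [RHS]big_seq; apply: eq_bigr => b _.
by rewrite mulnCA.
Qed.

(** Bilinearity separates the geometry, namely how often positions [s] and [t] land on [u] and [w],
    from the finite table of the patterns. *)
Lemma incidence_fin L r g g' u w i j : all (good r) L ->
  incidence (instances Ts e L) (g, Some (u, i)) (g', Some (w, j)) =
  \sum_(s < r) \sum_(t < r) (\sum_(k <- e) (Ts k s == u) * (Ts k t == w)) *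
    incidence L (symbol g s i) (symbol g' t j).
Proof.
move=> /allP gL; rewrite incidence_instances.
under [RHS]eq_bigr do under eq_bigr do rewrite big_distrl /=.
under [RHS]eq_bigr do rewrite exchange_big /=.
rewrite [RHS]exchange_big; apply: eq_bigr => k _.
rewrite incidenceE big_map big_seq.
under eq_bigr => b bL do
  rewrite !(count_place _ _ _ _ (gL b bL)) big_distrl /=.
rewrite exchange_big; apply: eq_bigr => s _.
under eq_bigr do rewrite big_distrr /=.
rewrite exchange_big; apply: eq_bigr => t _.
rewrite incidenceE big_distrr /= [RHS]big_seq; apply: eq_bigr => b _.
by rewrite mulnACA.
Qed.

Lemma one_five_instances L r : all (good r) L ->
  (forall k, k \in e -> {in gtn r &, injective (Ts k)}) ->
  all (@one_five _) (instances Ts e L).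
Proof.
move=> /allP gL injT; apply/allP => _ /allpairsP[[k b] /= [ke bL ->]].
have /andP[/and3P[ub sb cb] /allP gb] := gL b bL.
apply/and3P; split; rewrite ?size_map ?count_map //.
rewrite map_inj_in_uniq // => -[g [[s l]|]] [h [[t l']|]] /gb /= p /gb /= q;
  case=> -> // /(injT _ ke).
case/andP: p q => sr l5 /andP[tr l5'] => /(_ sr tr) -> /(congr1 val).
by rewrite /= !inordK // => ->.
Qed.
End Instances.

(* V has odd order, and Q indexes the pairs {v, - v} of nonzero elements. *)
Section HalfSystem.
Variables (V : finZmodType) (Q : finType) (h : Q -> V).
Hypothesis halves : forall z : V,
  \sum_(a : Q) ((z == h a) + (z == - h a)%R) = (z != 0%R).
Hypothesis dblI : injective (fun z : V => z + z)%R.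
Implicit Types (u w x z : V) (a b c : Q).

Lemma h_neq0 a : h a != 0%R.
Proof.
have := halves 0%R; rewrite eqxx => /eqP; rewrite sum_nat_eq0.
by move=> /forallP/(_ a); rewrite addn_eq0 eqb0 eq_sym => /andP[].
Qed.

Lemma dbl_eq0 z : (z + z == 0)%R = (z == 0%R).
Proof. by rewrite -[X in _ == X]addr0 (inj_eq dblI). Qed.

(** * The second family: fibres in progression x - a, x, x + a *)

Definition triple_at (xa : V * Q) : nat -> V :=
  nth xa.1 [:: xa.1; xa.1 - h xa.2; xa.1 + h xa.2]%R.

Lemma triple_at_inj xa : {in gtn 3 &, injective (triple_at xa)}.
Proof.
case: xa => x a s t s3 t3; have ha := h_neq0 a.
have ha2 : (h a + h a != 0)%R by rewrite dbl_eq0.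
have e1 : (x == x - h a)%R = false.
  by rewrite -subr_eq0 opprB addrC subrK (negbTE ha).
have e2 : (x == x + h a)%R = false.
  by rewrite -subr_eq0 opprD addNKr oppr_eq0 (negbTE ha).
have e3 : (x - h a == x + h a)%R = false.
  by rewrite -subr_eq0 opprD addrACA subrr add0r -opprD oppr_eq0 (negbTE ha2).
move: s t s3 t3; rewrite /triple_at => -[|[|[|//]]] [|[|[|//]]] //= _ _ /eqP;
  by rewrite ?(e1, e2, e3) // eq_sym ?(e1, e2, e3).
Qed.

Lemma sum_delta (c u : V) (f : V -> nat) :
  \sum_(x : V) (x + c == u)%R * f x = f (u - c)%R.
Proof.
rewrite (bigD1 (u - c)%R) //= subrK eqxx mul1n big1 ?addn0 // => x ne.
by rewrite -(can2_eq (addrK c) (subrK c)) eq_sym in ne; rewrite eq_sym (negbTE ne).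
Qed.

Definition hits (d : V) : nat := \sum_a (h a == d).

Lemma hitsN d : hits d + hits (- d)%R = (d != 0%R).
Proof.
rewrite -halves -big_split /=; apply: eq_bigr => a _.
by rewrite (eq_sym d) (eq_sym d) eqr_oppLR.
Qed.

Definition dbl_hits (d : V) : nat := \sum_a (h a + h a == d)%R.

(** Doubling is injective, hence bijective on the finite group [V], and commutes with negation; so
    the doubled representatives are again representatives up to sign. *)
Lemma dbl_hitsN d : dbl_hits d + dbl_hits (- d)%R = (d != 0%R).
Proof.
have eD z : dbl_hits (z + z)%R = hits z.
  by apply: eq_bigr => a _; rewrite (inj_eq dblI).
have [f _ fK] := injF_bij dblI; rewrite -(fK d) opprD !eD hitsN.
by rewrite dbl_eq0.
Qed.

Lemma sum_triple s t u w :
  \sum_(xa : V * Q) (triple_at xa s == u) * (triple_at xa t == w) =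
  \sum_a \sum_x (triple_at (x, a) s == u) * (triple_at (x, a) t == w).
Proof. by rewrite exchange_big /= pair_big; apply: eq_bigr => -[]. Qed.

Lemma sum_triple_pt s u : s < 3 ->
  \sum_(xa : V * Q) (triple_at xa s == u) = #|Q|.
Proof.
move=> s3; transitivity (\sum_a \sum_x (triple_at (x, a) s == u)).
  by rewrite exchange_big /= pair_big; apply: eq_bigr => -[].
rewrite -sum1_card; apply: eq_bigr => a _.
case: s s3 => [|[|[|//]]] _; rewrite /triple_at /=.
- rewrite -(sum_delta 0%R u (fun=> 1)); apply: eq_bigr => x _.
  by rewrite addr0 muln1.
- rewrite -(sum_delta (- h a)%R u (fun=> 1)); apply: eq_bigr => x _.
  by rewrite muln1.
- rewrite -(sum_delta (h a)%R u (fun=> 1)); apply: eq_bigr => x _.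
  by rewrite muln1.
Qed.

(** Two distinct positions differ by one of a, - a, 2a, - 2a, so only the difference of [u] and [w]
    matters; equal positions require u = w. *)
Lemma sum_triple_table (F : nat -> nat -> nat) u w :
  \sum_(s < 3) \sum_(t < 3)
    (\sum_(xa : V * Q) (triple_at xa s == u) * (triple_at xa t == w)) * F s t =
  (u == w) * #|Q| * (F 0 0 + F 1 1 + F 2 2) +
  (hits (w - u)%R * (F 0 2 + F 1 0) + hits (u - w)%R * (F 2 0 + F 0 1) +
   dbl_hits (w - u)%R * F 1 2 + dbl_hits (u - w)%R * F 2 1).
Proof.
have diag s : s < 3 ->
    \sum_(xa : V * Q) (triple_at xa s == u) * (triple_at xa s == w) =
    (u == w) * #|Q|.
  move=> s3; rewrite -(sum_triple_pt u s3) big_distrr /=; apply: eq_bigr => xa _.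
  by case: (_ =P u) => [->|_]; rewrite ?mul1n ?muln1 // muln0.
(* The point [u] at position [s] determines x; what remains is a condition on a alone. *)
have off s t (d d' : Q -> V) :
    (forall x a, triple_at (x, a) s = x + d a)%R ->
    (forall x a, triple_at (x, a) t = x + d' a)%R ->
    \sum_(xa : V * Q) (triple_at xa s == u) * (triple_at xa t == w) =
    \sum_a (d' a - d a == w - u)%R.
  move=> dE dE'; rewrite sum_triple; apply: eq_bigr => a _.
  transitivity (nat_of_bool (u - d a + d' a == w)%R); last first.
    rewrite -addrA [(u + _)%R]addrC (can2_eq (addrK u) (subrK u)).
    by rewrite [(- _ + _)%R]addrC.
  rewrite -(sum_delta (d a) u (fun x => (x + d' a == w)%R : nat)).
  by apply: eq_bigr => x _; rewrite dE dE'.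
have at0 (x : V) (a : Q) : triple_at (x, a) 0 = (x + 0)%R.
  by rewrite /triple_at /= addr0.
have at1 (x : V) (a : Q) : triple_at (x, a) 1 = (x + - h a)%R by [].
have at2 (x : V) (a : Q) : triple_at (x, a) 2 = (x + h a)%R by [].
rewrite !big_ord_recl !big_ord0 /= /bump /= !addn0 !diag //.
rewrite (off 0 1 _ _ at0 at1) (off 0 2 _ _ at0 at2) (off 1 0 _ _ at1 at0).
rewrite (off 1 2 _ _ at1 at2) (off 2 0 _ _ at2 at0) (off 2 1 _ _ at2 at1).
have eN (z : V) : (- z == w - u)%R = (z == u - w)%R by rewrite eqr_oppLR opprB.
have -> : \sum_a (- h a - 0 == w - u)%R = hits (u - w)%R.
  by apply: eq_bigr => a _; rewrite subr0 eN.
have -> : \sum_a (h a - 0 == w - u)%R = hits (w - u)%R.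
  by apply: eq_bigr => a _; rewrite subr0.
have -> : \sum_a (0 - - h a == w - u)%R = hits (w - u)%R.
  by apply: eq_bigr => a _; rewrite sub0r opprK.
have -> : \sum_a (h a - - h a == w - u)%R = dbl_hits (w - u)%R.
  by apply: eq_bigr => a _; rewrite opprK.
have -> : \sum_a (0 - h a == w - u)%R = hits (u - w)%R.
  by apply: eq_bigr => a _; rewrite sub0r eN.
have -> : \sum_a (- h a - h a == w - u)%R = dbl_hits (u - w)%R.
  by apply: eq_bigr => a _; rewrite -opprD eN.
by rewrite !addn1 !mulnDr; move: ((u == w) * #|Q|) => N; lia.
Qed.

(** Exactly one of w - u and u - w is a representative, and exactly one is a doubled representative;
    by the hypotheses on [F] it is irrelevant which. *)
Lemma sum_triple_neq (F : nat -> nat -> nat) u w : u != w ->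
  F 0 2 + F 1 0 = F 2 0 + F 0 1 -> F 1 2 = F 2 1 ->
  \sum_(s < 3) \sum_(t < 3)
    (\sum_(xa : V * Q) (triple_at xa s == u) * (triple_at xa t == w)) * F s t =
  F 0 2 + F 1 0 + F 1 2.
Proof.
move=> uw e1 e2; rewrite sum_triple_table -e1 -e2 (negbTE uw).
have := hitsN (w - u)%R; have := dbl_hitsN (w - u)%R.
rewrite opprB subr_eq0 eq_sym uw => d1 d2.
by rewrite !mul0n add0n -mulnDl -addnA -mulnDl d1 d2 !mul1n.
Qed.

Lemma sum_triple_eq (F : nat -> nat -> nat) u :
  \sum_(s < 3) \sum_(t < 3)
    (\sum_(xa : V * Q) (triple_at xa s == u) * (triple_at xa t == u)) * F s t =
  #|Q| * (F 0 0 + F 1 1 + F 2 2).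
Proof.
rewrite sum_triple_table subrr eqxx.
have := hitsN 0%R; have := dbl_hitsN 0%R; rewrite oppr0 eqxx /= => d1 d2.
have [-> ->] : hits 0%R = 0 /\ dbl_hits 0%R = 0 by lia.
by rewrite mul1n !mul0n !addn0.
Qed.

(** * Sign classes of V and the pair counts of the third family *)

Definition orbit_mem (z : V) (a : Q) : nat := (z == h a) + (z == - h a)%R.

Lemma orbit_memP z : z != 0%R -> exists a, forall b, orbit_mem z b = (b == a).
Proof.
move=> z0; have := halves z; rewrite z0 => /eqP/sum_nat_eq1[a [_ ea ha]].
by exists a => b; case: eqP => [-> //|/eqP ba]; apply: ha.
Qed.

Lemma orbit_mem0 a : orbit_mem 0%R a = 0.
Proof.
by rewrite /orbit_mem eq_sym (negbTE (h_neq0 a)) eq_sym oppr_eq0 (negbTE (h_neq0 a)).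
Qed.

Lemma orbit_memN z a : orbit_mem (- z)%R a = orbit_mem z a.
Proof. by rewrite /orbit_mem eqr_oppLR eqr_opp addnC. Qed.

Lemma orbit_mem_inj z z' a :
  orbit_mem z a = 1 -> orbit_mem z' a = 1 -> z' = z \/ z' = (- z)%R.
Proof.
have me y : orbit_mem y a = 1 -> y = h a \/ y = (- h a)%R.
  by rewrite /orbit_mem; case: eqP; case: eqP; auto.
by move=> /me[] -> /me[] ->; rewrite ?opprK; auto.
Qed.

(** Each index contributes h a and - h a, and together these hit every nonzero element once. *)
Lemma card_V : #|V| = (2 * #|Q|).+1.
Proof.
rewrite (cardD1 0%R) inE add1n; congr S.
transitivity (\sum_(z : V) (z != 0%R : nat)).
  rewrite -sum1_card big_mkcond; apply: eq_bigr => z _.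
  by rewrite !inE andbT; case: eqP.
transitivity (\sum_(z : V) \sum_a orbit_mem z a).
  by apply: eq_bigr => z _; rewrite -halves.
rewrite exchange_big mulnC -sum_nat_const; apply: eq_bigr => a _.
rewrite big_split /= (bigD1 (h a)) //= eqxx big1 => [|z /negbTE -> //].
by rewrite (bigD1 (- h a)%R) //= eqxx big1 => [|z /negbTE -> //].
Qed.

Variable op : Q -> Q -> Q.
Hypothesis op_idem : forall a, op a a = a.
Hypothesis op_injr : forall a, injective (op a).
Hypothesis op_injl : forall b, injective (op^~ b).

Lemma sum_eq1 (f : Q -> nat) a : \sum_b (b == a) * f b = f a.
Proof.
by rewrite (bigD1 a) //= eqxx mul1n big1 ?addn0 // => b /negbTE ->; rewrite mul0n.
Qed.

(** The equation op a b = c has one solution b, and by idempotence it is a itself exactly when c =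
    a. *)
Lemma sum_op_row a c : \sum_b (a != b) * (op a b == c) = (a != c).
Proof.
have [f _ fK] := injF_bij (@op_injr a).
transitivity (\sum_b (b == f c) * (a != b)); last first.
  by rewrite sum_eq1 -(inj_eq (@op_injr a)) op_idem fK.
by apply: eq_bigr => b _; rewrite mulnC -(inj_eq (@op_injr a) b) fK.
Qed.

Lemma sum_op_col b c : \sum_a (a != b) * (op a b == c) = (b != c).
Proof.
have [f _ fK] := injF_bij (@op_injl b).
transitivity (\sum_a (a == f c) * (a != b)); last first.
  by rewrite sum_eq1 -(inj_eq (@op_injl b)) /= op_idem fK eq_sym.
by apply: eq_bigr => a _; rewrite mulnC -(inj_eq (@op_injl b) a (f c)) /= fK.
Qed.

Definition sum2 (f : Q -> Q -> nat) := \sum_a \sum_b (a != b) * f a b.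

Lemma sum2_pt (f : Q -> Q -> nat) a0 :
  sum2 (fun a b => ((a == a0) + (b == a0)) * f a b) =
  \sum_b (a0 != b) * f a0 b + \sum_a (a != a0) * f a a0.
Proof.
transitivity (\sum_a (a == a0) * (\sum_b (a != b) * f a b) +
              \sum_a \sum_b (b == a0) * ((a != b) * f a b)).
  rewrite -big_split; apply: eq_bigr => a _.
  rewrite big_distrr -big_split; apply: eq_bigr => b _ /=.
  by rewrite mulnDl mulnDr ![_ * ((_ == _) * _)]mulnCA.
by rewrite sum_eq1; congr (_ + _); apply: eq_bigr => a _; rewrite sum_eq1.
Qed.

Lemma sum_neq1 a : \sum_b (a != b) = #|Q|.-1.
Proof.
rewrite -(cardC1 a) -sum1_card [RHS]big_mkcond; apply: eq_bigr => b _.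
by rewrite !inE eq_sym; case: eqP.
Qed.

Lemma sum2_deg a : sum2 (fun a' b => (a' == a) + (b == a)) = 2 * #|Q|.-1.
Proof.
transitivity (sum2 (fun a' b => ((a' == a) + (b == a)) * 1)).
  by apply: eq_bigr => a' _; apply: eq_bigr => b _; rewrite muln1.
rewrite sum2_pt mul2n -addnn; congr (_ + _); rewrite -(sum_neq1 a);
  by apply: eq_bigr => b _; rewrite muln1 // eq_sym.
Qed.

(** For a' != b at most one of the two indicators is 1, so their sum is its own square. *)
Lemma sum2_sqr a :
  sum2 (fun a' b => ((a' == a) + (b == a)) * ((a' == a) + (b == a))) = 2 * #|Q|.-1.
Proof.
rewrite -(sum2_deg a); apply: eq_bigr => a' _; apply: eq_bigr => b _.
case: (altP (a' =P a)) => [->|_]; last by case: (b == a).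
by rewrite (eq_sym a); case: (b == a).
Qed.

Lemma sum2_two a a' : a != a' ->
  sum2 (fun b b' => ((b == a) + (b' == a)) * ((b == a') + (b' == a'))) = 2.
Proof.
move=> ne; rewrite sum2_pt.
under eq_bigr do rewrite (negbTE ne) add0n mulnC.
under [X in _ + X]eq_bigr do rewrite (negbTE ne) addn0 mulnC.
by rewrite !sum_eq1 ne eq_sym ne.
Qed.

Lemma sum2_op c : sum2 (fun a b => op a b == c) = #|Q|.-1.
Proof.
rewrite -(sum_neq1 c); apply: eq_bigr => a _.
by rewrite sum_op_row eq_sym.
Qed.

Lemma sum2_pt_op a c :
  sum2 (fun a' b => ((a' == a) + (b == a)) * (op a' b == c)) = 2 * (a != c).
Proof. by rewrite sum2_pt sum_op_row sum_op_col mul2n addnn. Qed.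

(** How many of the offsets 0, h a, - h a, h b, - h b from the centre of a block equal [z]. *)
Definition cover (z : V) (a b : Q) : nat :=
  (z == 0%R) + orbit_mem z a + orbit_mem z b.

Definition cover_cover (z z' : V) :=
  sum2 (fun a b => cover z a b * cover z' a b).
Definition cover_single (z z' : V) :=
  sum2 (fun a b => cover z a b * orbit_mem z' (op a b)).

Lemma eq_sum2 (f f' : Q -> Q -> nat) :
  (forall a b, f a b = f' a b) -> sum2 f = sum2 f'.
Proof. by move=> e; apply: eq_bigr => a _; apply: eq_bigr => b _; rewrite e. Qed.

Lemma cover0 a b : cover 0%R a b = 1.
Proof. by rewrite /cover eqxx !orbit_mem0. Qed.

Lemma coverP z : z != 0%R ->
  exists a, forall b b', cover z b b' = (b == a) + (b' == a).
Proof.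
move=> z0; have [a ha] := orbit_memP z0; exists a => b b'.
by rewrite /cover (negbTE z0) !ha.
Qed.

(** The centre is covered by every pair, and a nonzero element by the 2(k - 1) ordered pairs
    containing its class. Two different classes lie together only in the 2 orderings of one pair. *)
Lemma cover_coverE z z' : z != z' ->
  cover_cover z z' =
  if [|| z == 0, z' == 0 | z' == - z]%R then 2 * #|Q|.-1 else 2.
Proof.
move=> zz'; have [z0|z0] := eqVneq z 0%R.
  have [|a ha] := @coverP z'; first by rewrite -z0 eq_sym.
  by rewrite -(sum2_deg a); apply: eq_sum2 => b b'; rewrite z0 cover0 mul1n ha.
have [a ha] := coverP z0; have [z'0|z'0] := eqVneq z' 0%R.
  by rewrite -(sum2_deg a); apply: eq_sum2 => b b'; rewrite z'0 cover0 muln1 ha.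
have [a' ha'] := coverP z'0 => /=.
have [e|ne] := eqVneq z' (- z)%R.
  rewrite -(sum2_sqr a); apply: eq_sum2 => b b'; rewrite -ha.
  by rewrite e /cover oppr_eq0 !orbit_memN.
rewrite -(@sum2_two a a'); first by apply: eq_sum2 => b b'; rewrite ha ha'.
(* Equal classes leave only z' = z, which is excluded, or z' = - z. *)
apply: contraNneq ne => aa'.
have [b hb] := orbit_memP z0; have [b' hb'] := orbit_memP z'0.
have := ha b b; have := ha' b' b'.
rewrite /cover (negbTE z0) (negbTE z'0) !hb !hb' !eqxx.
move=> e' e; have eb : b = b'.
  apply/eqP; move: e e'; rewrite aa'.
  by case: (b =P a') => // ->; case: (b' =P a') => // ->.
have := @orbit_mem_inj z z' b; rewrite hb eb hb' eqxx => -[] // e2; last by apply/eqP.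
by rewrite e2 eqxx in zz'.
Qed.

(** The single point never lies on the central fibre. If its class is c, then op a b = c for k - 1
    pairs in all, and for one pair in the row and one in the column of each class other than c. *)
Lemma cover_singleE z z' :
  cover_single z z' = if z' == 0%R then 0 else if z == 0%R then #|Q|.-1
               else 2 * ((z' != z) && (z' != - z)%R).
Proof.
have [->|z'0] := eqVneq z' 0%R.
  rewrite /cover_single /sum2 big1 // => a _.
  by rewrite big1 // => b _; rewrite orbit_mem0 !muln0.
have [c hc] := orbit_memP z'0; have [->|z0] := eqVneq z 0%R.
  by rewrite -(sum2_op c); apply: eq_sum2 => a b; rewrite cover0 mul1n hc.
have [a ha] := orbit_memP z0.
transitivity (2 * (a != c)).
  rewrite -sum2_pt_op; apply: eq_sum2 => b b'.
  by rewrite /cover (negbTE z0) !ha hc.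
congr (2 * nat_of_bool _); rewrite -negb_or; congr (~~ _).
apply/eqP/orP => [ac|e].
  have := @orbit_mem_inj z z' a; rewrite ha hc ac eqxx.
  by case=> // ->; rewrite eqxx; auto.
have e' : orbit_mem z' a = 1 by case: e => /eqP ->; rewrite ?orbit_memN ha eqxx.
by apply/eqP; move: e'; rewrite hc; case: eqP.
Qed.

Definition midpoint (u w : V) : V := finv (fun z : V => z + z)%R (u + w)%R.

Lemma midpointE u w : (midpoint u w + midpoint u w = u + w)%R.
Proof. exact: (f_finv dblI). Qed.

(** The offsets of [u] and [w] from x are opposite exactly when 2x = u + w. *)
Lemma reflection_eq u w x : (w - x == - (u - x))%R = (x == midpoint u w).
Proof.
rewrite -(inj_eq dblI) midpointE opprB.
by rewrite subr_eq addrAC eq_sym subr_eq eq_sym addrC eq_sym (addrC u).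
Qed.

Lemma midpoint_neq u w : u != w -> uniq [:: u; w; midpoint u w].
Proof.
move=> uw; rewrite /= !inE negb_or uw /= andbT -(inj_eq dblI) -(inj_eq dblI w).
by rewrite midpointE (inj_eq (addrI u)) uw (inj_eq (addIr w)) eq_sym uw.
Qed.

Lemma sum_mem n (s : seq V) : uniq s -> \sum_x n * (x \in s) = n * size s.
Proof.
move=> us; rewrite -big_distrr -(card_uniqP us) -sum1_card; congr (_ * _).
by rewrite [RHS]big_mkcond; apply: eq_bigr => x _; case: (x \in s).
Qed.

Lemma card_Q_gt0 u w : u != w -> 0 < #|Q|.
Proof.
by rewrite -subr_eq0 => /orbit_memP[a _]; apply/card_gt0P; exists a.
Qed.

(* The values at x = u, x = w and the midpoint are exceptional. *)
Lemma sum_cover_cover u w : u != w ->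
  2 * \sum_x cover_cover (u - x)%R (w - x)%R = 20 * #|Q|.-1.
Proof.
move=> uw; have Q0 := card_Q_gt0 uw.
(* An exceptional term is 2(k - 1), any other is 2; adding 4 to the former gives 2 + 2k and avoids
   subtraction. *)
have E : \sum_x (cover_cover (u - x)%R (w - x)%R +
                 4 * (x \in [:: u; w; midpoint u w])) =
       \sum_x (2 + 2 * #|Q| * (x \in [:: u; w; midpoint u w])).
  apply: eq_bigr => x _; rewrite cover_coverE ?(inj_eq (addIr _)) //.
  rewrite !subr_eq0 reflection_eq !inE (eq_sym u) (eq_sym w).
  by case: ifP => _; case: #|Q| Q0 => //= q _; lia.
rewrite big_split [RHS]big_split /= !sum_mem ?midpoint_neq // in E.
move: E; rewrite (sum_nat_const _ 2) card_V /=.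
by move: (\sum_x _) (#|Q|) Q0 => N [] // q _; lia.
Qed.

(** For u != w the term is k - 1 at x = u, 0 at x = w and at the midpoint, and 2 at the remaining 2k
    - 2 elements. *)
Lemma sum_cover_single u w :
  \sum_x cover_single (u - x)%R (w - x)%R = 5 * (u != w) * #|Q|.-1.
Proof.
have [<-|uw] := eqVneq u w.
  by rewrite big1 // => x _; rewrite cover_singleE eqxx /=; case: eqP.
have Q0 := card_Q_gt0 uw.
have E : \sum_x (cover_single (u - x)%R (w - x)%R +
                 2 * (x \in [:: u; w; midpoint u w])) =
       \sum_x (2 + #|Q|.-1 * (x \in [:: u])).
  apply: eq_bigr => x _; rewrite cover_singleE.
  rewrite !subr_eq0 reflection_eq (inj_eq (addIr _)) !inE (eq_sym u) (eq_sym w x).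
  rewrite (eq_sym w) uw /=; have [->|xw] := eqVneq x w.
    by rewrite orbT (eq_sym w u) (negbTE uw) muln0.
  have [->|xu] := eqVneq x u; first by case: #|Q| Q0 => //= q _; lia.
  by rewrite muln0; case: eqP.
rewrite big_split [RHS]big_split /= !sum_mem ?midpoint_neq // in E.
move: E; rewrite (sum_nat_const _ 2) card_V /=.
by move: (\sum_x _) (#|Q|) Q0 => N [] // q _; lia.
Qed.

(** * The blocks of the third family and the union of all three *)

Definition main_at (k : V * (Q * Q) * bool) : nat -> V :=
  let: (x, (a, b), e) := k in
  nth x [:: x; x + h a; x - h a; x + h b; x - h b;
            if e then x + h (op a b) else x - h (op a b)]%R.

Arguments main_at : simpl never.

Definition main_index : seq (V * (Q * Q) * bool) :=
  [seq k <- enum {: V * (Q * Q) * bool} | k.1.2.1 != k.1.2.2].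

Lemma sum_main (f : V * (Q * Q) * bool -> nat) :
  \sum_(k <- main_index) f k =
  \sum_x sum2 (fun a b => f (x, (a, b), true) + f (x, (a, b), false)).
Proof.
rewrite big_filter big_enum_cond big_mkcond /sum2.
under [RHS]eq_bigr => x _ do rewrite pair_bigA /=.
rewrite pair_bigA /=.
transitivity (\sum_(p : V * (Q * Q)) \sum_e
    (if p.2.1 != p.2.2 then f (p, e) else 0)).
  by rewrite pair_bigA /=; apply: eq_bigr => -[].
apply: eq_bigr => -[x [a b]] _; rewrite big_bool /=.
by case: (a != b); rewrite ?mul1n.
Qed.

Lemma main_cover x a b e u :
  \sum_(s < 5) (main_at (x, (a, b), e) s == u) = cover (u - x)%R a b.
Proof.
rewrite !big_ord_recl big_ord0 /main_at /= addn0 /cover /orbit_mem.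
have e0 y : (u - x == y)%R = (x + y == u)%R by rewrite subr_eq addrC eq_sym.
by rewrite !e0 addr0 !addnA.
Qed.

Lemma main_single x a b u :
  (main_at (x, (a, b), true) 5 == u) + (main_at (x, (a, b), false) 5 == u) =
  orbit_mem (u - x)%R (op a b).
Proof.
have e0 y : (u - x == y)%R = (x + y == u)%R by rewrite subr_eq addrC eq_sym.
by rewrite /orbit_mem /main_at !e0.
Qed.

(** The six offsets differ: no representative is zero or its own negative, distinct ones differ up
    to sign, and op a b is neither a nor b since [op] is idempotent and cancellative. *)
Lemma main_at_inj k : k \in main_index -> {in gtn 6 &, injective (main_at k)}.
Proof.
case: k => -[x [a b]] e; rewrite mem_filter /= => /andP[ab _].
pose o := [:: 0; h a; - h a; h b; - h b; if e then h (op a b) else - h (op a b)]%R.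
have oE s : s < 6 -> main_at (x, (a, b), e) s = (x + nth 0%R o s)%R.
  rewrite /main_at; move: s => [|[|[|[|[|[|//]]]]]] _ //=; first by rewrite addr0.
  by case: (e).
move=> s t s6 t6.
suff: main_at (x, (a, b), e) s = main_at (x, (a, b), e) t -> s = t by [].
rewrite (oE s) // (oE t) // => /addrI/eqP; rewrite nth_uniq //; first by move/eqP.
have ca : op a b != a by rewrite -{2}[a]op_idem (inj_eq (@op_injr a)) eq_sym.
have cb : op a b != b.
  by rewrite -{2}[b]op_idem (inj_eq (@op_injl b) a b).
have hN c : (h c != - h c)%R by rewrite -subr_eq0 opprK dbl_eq0 h_neq0.
have hD c d : c != d -> (h c != h d) && (h c != - h d)%R.
  move=> cd; have [b' hb] := orbit_memP (h_neq0 c); rewrite -negb_or.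
  apply: contra cd => e1.
  have := hb d; have := hb c; rewrite /orbit_mem eqxx.
  case: (c =P b') => // ec _; case: (d =P b') => [->|_]; first by rewrite ec.
  by case/orP: e1 => ->; rewrite ?addn1.
have h0 c : ((h c == 0%R) = false) * ((0%R == h c) = false) *
    ((- h c == 0)%R = false) * ((0 == - h c)%R = false).
  by rewrite ![0%R == _]eq_sym oppr_eq0 (negbTE (h_neq0 c)).
have hS c : ((h c == - h c)%R = false) * ((- h c == h c)%R = false).
  by rewrite [(- h c)%R == _]eq_sym (negbTE (hN c)).
have hh c d : c != d -> ((h c == h d) = false) * ((h c == - h d)%R = false) *
    ((- h c == h d)%R = false) * ((- h c == - h d)%R = false).
  by move/hD/andP=> [/negbTE e1 /negbTE e2]; rewrite eqr_opp eqr_oppLR e1 e2.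
rewrite eq_sym in ca; rewrite eq_sym in cb.
by rewrite /o /= !inE !h0 !hS !(hh _ _ ab) /=; case: (e);
   rewrite !h0 !(hh _ _ ca) !(hh _ _ cb).
Qed.

Definition main_blocks := instances main_at main_index transversal_patterns.
Definition triple_blocks := instances triple_at (enum {: V * Q}) triple_patterns.
Definition fill_blocks := instances (fun x _ => x) (enum V) fill_patterns.

(** Distinct positions of the plane part carry each pair of labels exactly once, which reduces the
    count to [cover_cover]; the two signs of the single point supply a factor 2. *)
Lemma main_same g u w i j : (u, i) != (w, j) ->
  incidence main_blocks (g, Some (u, i)) (g, Some (w, j)) =
  (u != w) * (20 * #|Q|.-1).
Proof.
have /and3P[_ _ gT] := good_patterns.
have /and3P[/allP tab _ _] := transversal_tableP g i j.
have {}tab s t : s < 6 -> t < 6 -> if s != t then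
    incidence transversal_patterns (symbol g s i) (symbol g t j)
      = (s < 5) && (t < 5)
    else i != j :> nat ->
      incidence transversal_patterns (symbol g s i) (symbol g t j) = 0.
  move=> s6 t6; have /tab /= : (s, t) \in grid 6 6.
    by apply/allpairsP; exists (s, t); rewrite !mem_iota.
  by case: eqP => _ /= => [/implyP e ij|/eqP]; first exact/eqP/e.
rewrite (incidence_fin _ _ _ _ _ _ _ _ gT); case: (altP (u =P w)) => [<-|uw].
  rewrite xpair_eqE eqxx /= => ij; rewrite big1 // => s _; rewrite big1 // => t _.
  have := tab s t (ltn_ord s) (ltn_ord t); case: eqP => [_ -> //|st _].
    by rewrite muln0.
  rewrite big_seq big1 // => k kI; apply/eqP; rewrite muln_eq0 !eqb0 -negb_and.
  apply/negP => /andP[/eqP <- /eqP e]; apply: st; apply/esym.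
  by apply: (main_at_inj kI) e; apply: ltn_ord.
move=> _; rewrite mul1n -(sum_cover_cover uw).
transitivity (\sum_(s < 5) \sum_(t < 5)
    \sum_(k <- main_index) (main_at k s == u) * (main_at k t == w)).
  have N0 s : \sum_(k <- main_index) (main_at k s == u) * (main_at k s == w) = 0.
    rewrite big1 // => k _; case: (altP (_ =P u)) => // ->.
    by rewrite (negbTE uw).
  rewrite big_ord_recr /= [X in _ + X]big1 ?addn0 => [|t _].
    apply: eq_bigr => s _; rewrite big_ord_recr /= (_ : _ * _ = 0) ?addn0.
      apply: eq_bigr => t _; have [->|st] := eqVneq (s : nat) t; first by rewrite N0.
      have := tab s t (ltnW (ltn_ord s)) (ltnW (ltn_ord t)); rewrite st => ->.
      by rewrite !ltn_ord muln1.
    have := tab s 5 (ltnW (ltn_ord s)) isT; rewrite ltn_eqF // => ->.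
    by rewrite andbF muln0.
  have [->|st] := eqVneq (t : nat) 5; first by rewrite N0.
  have := tab 5 t isT (ltn_ord t); rewrite eq_sym st => ->.
  by rewrite muln0.
(* The double sum over positions factors, block by block, into two coverage numbers. *)
transitivity (\sum_(k <- main_index) (\sum_(s < 5) (main_at k s == u)) *
                                     (\sum_(t < 5) (main_at k t == w))).
  under [RHS]eq_bigr do rewrite big_distrlr /=.
  by rewrite [RHS]exchange_big; apply: eq_bigr => s _; apply: exchange_big.
rewrite sum_main big_distrr; apply: eq_bigr => x _.
rewrite /cover_cover /sum2 big_distrr; apply: eq_bigr => a _ /=.
rewrite big_distrr; apply: eq_bigr => b _; rewrite /= !main_cover addnn -mul2n.
by rewrite mulnCA.
Qed.

(** One of the two points is the single one; each of the two choices contributes 5(k - 1) by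
    [sum_cover_single]. *)
Lemma main_diff g u w i j :
  incidence main_blocks (g, Some (u, i)) (~~ g, Some (w, j)) =
  (u != w) * (10 * #|Q|.-1).
Proof.
have /and3P[_ _ gT] := good_patterns.
have /and3P[_ /allP tab _] := transversal_tableP g i j.
have {}tab s t : s < 6 -> t < 6 ->
    incidence transversal_patterns (symbol g s i) (symbol (~~ g) t j)
      = (s < 5) (+) (t < 5).
  move=> s6 t6; have /tab /eqP // : (s, t) \in grid 6 6.
  by apply/allpairsP; exists (s, t); rewrite !mem_iota.
rewrite (incidence_fin _ _ _ _ _ _ _ _ gT).
transitivity (
  \sum_(s < 5) \sum_(k <- main_index) (main_at k s == u) * (main_at k 5 == w) +
  \sum_(t < 5) \sum_(k <- main_index) (main_at k 5 == u) * (main_at k t == w)).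
  rewrite big_ord_recr /=; congr (_ + _).
    apply: eq_bigr => s _; rewrite big_ord_recr /= big1 => [|t _].
      by rewrite (tab s 5 (ltnW (ltn_ord s)) isT) ltn_ord muln1.
    by rewrite (tab s t (ltnW (ltn_ord s)) (ltnW (ltn_ord t))) !ltn_ord muln0.
  rewrite big_ord_recr /= (tab 5 5 isT isT) muln0 addn0; apply: eq_bigr => t _.
  by rewrite (tab 5 t isT (ltnW (ltn_ord t))) ltn_ord muln1.
transitivity (\sum_x (cover_single (u - x)%R (w - x)%R +
                      cover_single (w - x)%R (u - x)%R)).
  rewrite exchange_big [X in _ + X]exchange_big -big_split sum_main.
  apply: eq_bigr => x _; rewrite -big_split; apply: eq_bigr => a _.
  rewrite -big_split; apply: eq_bigr => b _ /=.
  rewrite -!big_distrl -!big_distrr /= !main_cover -!main_single.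
  rewrite -mulnDr; congr (_ * _).
  by rewrite addnACA mulnDr [cover (w - x)%R _ _ * _]mulnC mulnDl.
rewrite big_split /= !sum_cover_single (eq_sym w).
by case: (u != w); move: (#|Q|.-1) => q /=; lia.
Qed.

Lemma main_inf g g' w j : incidence main_blocks (g, None) (g', Some (w, j)) = 0.
Proof.
have /and3P[_ _ gT] := good_patterns.
have /and3P[_ _ /allP tab] := transversal_tableP g j j.
rewrite (incidence_inf _ _ _ _ _ _ gT) big1 // => s _.
have /tab /eqP -> : symbol g' s j \in
    (~~ g, None) :: [seq symbol h s j | h <- [:: false; true], s <- iota 0 6].
  rewrite inE; apply/orP; right; apply/allpairsP; exists (g', val s).
  by rewrite mem_iota /= ltn_ord; case: (g').
by rewrite muln0.
Qed.

Lemma main_inf_inf g : incidence main_blocks (g, None) (~~ g, None) = 0.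
Proof.
have /and3P[_ _ /allP tab] := transversal_tableP g ord0 ord0.
have /eqP e := tab _ (mem_head _ _).
by rewrite incidence_inf_inf e muln0.
Qed.

Lemma fill_fin g g' u w i j :
  incidence fill_blocks (g, Some (u, i)) (g', Some (w, j)) =
  (u == w) * incidence fill_patterns (symbol g 0 i) (symbol g' 0 j).
Proof.
have /and3P[gF _ _] := good_patterns.
rewrite (incidence_fin _ _ _ _ _ _ _ _ gF).
have sum_pt : \sum_(x <- enum V) (x == u) * (x == w) = (u == w).
  rewrite big_enum (bigD1 u) //= eqxx mul1n big1 ?addn0 // => x /negbTE ->.
  by rewrite mul0n.
by rewrite big_ord1 big_ord1 sum_pt.
Qed.

Lemma fill_inf g g' w j :
  incidence fill_blocks (g, None) (g', Some (w, j)) =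
  incidence fill_patterns (g, None) (symbol g' 0 j).
Proof.
have /and3P[gF _ _] := good_patterns.
rewrite (incidence_inf _ _ _ _ _ _ gF).
have sum_pt : \sum_(x <- enum V) (x == w) = 1.
  by rewrite big_enum (bigD1 w) //= eqxx big1 ?addn0 // => x /negbTE ->.
by rewrite big_ord1 sum_pt mul1n.
Qed.

Lemma sum3 n (f : nat -> nat) : \sum_(s < 3) n * f s = n * (f 0 + f 1 + f 2).
Proof. by rewrite !big_ord_recl big_ord0 addn0 !mulnDr addnA. Qed.

Lemma triple_inf g g' w j :
  incidence triple_blocks (g, None) (g', Some (w, j)) =
  #|Q| * (incidence triple_patterns (g, None) (symbol g' 0 j) +
          incidence triple_patterns (g, None) (symbol g' 1 j) +
          incidence triple_patterns (g, None) (symbol g' 2 j)).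
Proof.
have /and3P[_ gT _] := good_patterns.
rewrite (incidence_inf _ _ _ _ _ _ gT).
transitivity (\sum_(s < 3) #|Q| * incidence triple_patterns (g, None) (symbol g' s j)).
  by apply: eq_bigr => s _; rewrite big_enum /= sum_triple_pt.
exact: (sum3 _ (fun s => incidence triple_patterns (g, None) (symbol g' s j))).
Qed.

Lemma triple_fin_eq g g' u i j :
  incidence triple_blocks (g, Some (u, i)) (g', Some (u, j)) =
  #|Q| * (incidence triple_patterns (symbol g 0 i) (symbol g' 0 j) +
          incidence triple_patterns (symbol g 1 i) (symbol g' 1 j) +
          incidence triple_patterns (symbol g 2 i) (symbol g' 2 j)).
Proof.
have /and3P[_ gT _] := good_patterns.
rewrite (incidence_fin _ _ _ _ _ _ _ _ gT).
rewrite -(sum_triple_eq (fun s t =>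
  incidence triple_patterns (symbol g s i) (symbol g' t j)) u).
by apply: eq_bigr => s _; apply: eq_bigr => t _; rewrite big_enum.
Qed.

Lemma triple_fin_neq g g' u w i j : u != w ->
  incidence triple_blocks (g, Some (u, i)) (g', Some (w, j)) =
  if g' == g then 32 else 15.
Proof.
move=> uw; have /and3P[_ gT _] := good_patterns.
have /and5P[_ _ /allP tab _ _] := triple_tableP g i j.
have /tab /and3P[/eqP e1 /eqP e2 /eqP e3] : g' \in [:: false; true] by case: (g').
rewrite (incidence_fin _ _ _ _ _ _ _ _ gT) -e3.
rewrite -(sum_triple_neq (F := fun s t =>
  incidence triple_patterns (symbol g s i) (symbol g' t j)) uw e1 e2).
by apply: eq_bigr => s _; apply: eq_bigr => t _; rewrite big_enum.
Qed.

Definition blocks := fill_blocks ++ triple_blocks ++ main_blocks.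

Lemma card_points : #|{: option (V * 'I_5)}| = 10 * #|Q| + 6.
Proof. by rewrite card_option card_prod card_ord card_V; lia. Qed.

Lemma blocks_one_five : all (@one_five _) blocks.
Proof.
have /and3P[gF gT gM] := good_patterns; rewrite !all_cat; apply/and3P; split.
- by apply: (one_five_instances gF) => x _ [] // [].
- by apply: (one_five_instances gT) => k _; apply: triple_at_inj.
- exact: (one_five_instances gM) main_at_inj.
Qed.

(** The target 20k + 12 arises as 20(k - 1) + 32 on distinct fibres, and as 12 + 20k on one fibre or
    with infinity. *)
Lemma blocks_same g (z z' : option (V * 'I_5)) : z != z' ->
  incidence blocks (g, z) (g, z') = 2 * #|{: option (V * 'I_5)}|.
Proof.
rewrite card_points !incidence_cat.
have inf (w : V) j : incidence fill_blocks (g, None) (g, Some (w, j)) +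
    (incidence triple_blocks (g, None) (g, Some (w, j)) +
     incidence main_blocks (g, None) (g, Some (w, j))) = 2 * (10 * #|Q| + 6).
  rewrite fill_inf triple_inf main_inf.
  have /and5P[_ _ /eqP -> _ _] := fill_tableP g j j.
  have /and5P[_ _ _ /eqP -> _] := triple_tableP g j j; lia.
case: z => [[u i]|]; case: z' => [[w j]|] //; last first.
  by move=> _; rewrite 3!(incidenceC _ (g, Some _)) inf.
rewrite (inj_eq Some_inj) => ne; rewrite main_same // fill_fin.
have [uw|uw] := eqVneq u w; last first.
  rewrite triple_fin_neq // eqxx /=; have := card_Q_gt0 uw.
  by case: #|Q| => //= q _; lia.
have ij : i != j :> nat.
  apply: contraNneq ne => ij; rewrite uw xpair_eqE eqxx.
  exact/eqP/val_inj.
rewrite uw triple_fin_eq /=.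
have /and5P[/implyP/(_ ij)/eqP -> _ _ _ _] := fill_tableP g i j.
have /and5P[/implyP/(_ ij)/eqP -> _ _ _ _] := triple_tableP g i j; lia.
Qed.

Lemma blocks_diff g (z z' : option (V * 'I_5)) :
  incidence blocks (g, z) (~~ g, z') = #|{: option (V * 'I_5)}| - 1.
Proof.
rewrite card_points !incidence_cat.
have inf g' (w : V) j : incidence fill_blocks (g', None) (~~ g', Some (w, j)) +
    (incidence triple_blocks (g', None) (~~ g', Some (w, j)) +
     incidence main_blocks (g', None) (~~ g', Some (w, j))) = 10 * #|Q| + 6 - 1.
  rewrite fill_inf triple_inf main_inf.
  have /and5P[_ _ _ /eqP -> _] := fill_tableP g' j j.
  have /and5P[_ _ _ _ /andP[/eqP -> _]] := triple_tableP g' j j; lia.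
case: z => [[u i]|]; case: z' => [[w j]|] //; last 2 first.
- by rewrite 3!(incidenceC _ (g, Some _)) -{2 4 6}[g]negbK inf.
(* The points at infinity meet only in the 2k + 1 copies of the design for n = 6, five times in
   each. *)
- rewrite main_inf_inf !incidence_inf_inf -cardT card_V.
  have /and5P[_ _ _ _ /eqP ->] := fill_tableP g ord0 ord0.
  have /and5P[_ _ _ _ /andP[_ /eqP ->]] := triple_tableP g ord0 ord0; lia.
rewrite main_diff // fill_fin.
have /and5P[_ /eqP -> _ _ _] := fill_tableP g i j.
have [->|uw] := eqVneq u w; last first.
  rewrite triple_fin_neq //; have := card_Q_gt0 uw.
  case: #|Q| => //= q _; case: (g) => /=; lia.
rewrite triple_fin_eq /=.
have /and5P[_ /eqP -> _ _ _] := triple_tableP g i j; lia.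
Qed.

Lemma gdd_of_half_system :
  exists (T : finType) (P : {set {set T}}) (C : seq {set T}),
  is_GDD (10 * #|Q| + 6) 2 6 (2 * (10 * #|Q| + 6)) (10 * #|Q| + 6 - 1) P C /\
  has_configuration 1 5 P C.
Proof.
rewrite -card_points; apply: (gdd_of_incidence _ blocks_one_five blocks_same).
  by rewrite card_points addn_gt0 orbT.
exact: (blocks_diff false).
Qed.
End HalfSystem.

(** * Existence of half systems and of idempotent quasigroups *)

Lemma odd_dblI k : injective (fun z : 'I_(k.*2).+1 => z + z)%R.
Proof.
suff H (m a b : nat) : m = (k.*2).+1 -> a < m -> b < m ->
    (a + a) %% m = (b + b) %% m -> a = b.
  by move=> z w /(congr1 val) e; apply: val_inj;
     exact: (H _ _ _ erefl (ltn_ord z) (ltn_ord w) e).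
move=> mk am bm e; have := divn_eq (a + a) m; have := divn_eq (b + b) m.
rewrite e; have : (b + b) %% m < m by rewrite ltn_mod; lia.
move: (_ %/ m) (_ %/ m) (_ %% m) => p q r rm eb ea.
(* Both quotients are at most 1, and they agree because 2a and 2b cannot differ by the odd number
   m. *)
have : q <= 1 by nia.
have : p <= 1 by nia.
by case: p ea => [|[|//]] ea _; case: q eb => [|[|//]] eb _; lia.
Qed.

Lemma half_sum q v : v < (q.*2).+1 ->
  \sum_(i < q) ((v == i.+1) + (v == q.*2 - i)) = (v != 0).
Proof.
move=> vk; case: (posnP v) => [->|v0].
  by rewrite big1 // => i _; have := ltn_ord i; lia.
have [vq|vq] := leqP v q.
  have ik : v.-1 < q by lia.
  rewrite (bigD1 (Ordinal ik)) //= big1 => [|i]; first lia.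
  by rewrite -(inj_eq val_inj) /=; have := ltn_ord i; lia.
have ik : q.*2 - v < q by lia.
rewrite (bigD1 (Ordinal ik)) //= big1 => [|i]; first lia.
by rewrite -(inj_eq val_inj) /=; have := ltn_ord i; lia.
Qed.

(** The representatives are 1, ..., q modulo 2q + 1, numbered by the rank in [Q]; the negative of i
    + 1 is 2q - i. *)
Definition half_point (Q : finType) (a : Q) : 'I_(#|Q|.*2).+1 :=
  inZp (enum_rank a).+1.

Lemma half_pointP (Q : finType) (z : 'I_(#|Q|.*2).+1) :
  \sum_(a : Q) ((z == half_point a) + (z == - half_point a)%R) = (z != 0%R).
Proof.
have vE (i : 'I_#|Q|) : val (half_point (enum_val i)) = i.+1.
  by rewrite /= enum_valK modn_small // ltnS -addnn ltn_addr.
rewrite (reindex_onto enum_val enum_rank) => [|a _]; last exact: enum_rankK.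
under eq_bigl do rewrite enum_valK eqxx.
under eq_bigr => i _.
  have -> : (z == half_point (enum_val i)) = (val z == i.+1).
    by rewrite -(inj_eq val_inj) vE.
  have -> : (z == - half_point (enum_val i))%R = (val z == #|Q|.*2 - i).
    rewrite -(inj_eq val_inj) /= enum_valK [(i.+1 %% _)%N]modn_small ?subSS.
      by rewrite modn_small // ltnS leq_subr.
    by rewrite ltnS -addnn ltn_addr.
  over.
have -> : (z != 0%R) = (val z != 0) by rewrite -(inj_eq val_inj).
exact: (half_sum (ltn_ord z)).
Qed.

(* For odd k take b, a |-> 2 b - a on a cyclic group; for even k > 2 prolong the
   table of order k - 1 along its transversal b = a + g. *)
Lemma idempotent_quasigroup k : k != 2 ->
  exists (Q : finType) (op : Q -> Q -> Q),
  [/\ #|Q| = k, forall a, op a a = a, forall a, injective (op a)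
    & forall b, injective (op^~ b)].
Proof.
have [j [->|->]] : exists j, k = (j.*2).+1 \/ k = j.*2.
  by exists k./2; rewrite -{1 3}(odd_double_half k); case: (odd k); auto.
  move=> _; exists 'I_(j.*2).+1, (fun a b => b + b - a)%R; split.
  - by rewrite card_ord.
  - by move=> a; rewrite addrK.
  - by move=> a b c /addIr/odd_dblI.
  - by move=> b a c /addrI/oppr_inj.
case: j => [_|j jn2].
  exists 'I_0, (fun a _ => a); split; rewrite ?card_ord //; by case.
have j0 : 0 < j by case: j jn2.
have [g g0] : exists g : 'I_(j.*2).+1, g != 0%R.
  by exists (inZp 1); rewrite -(inj_eq val_inj) /= modn_small //; lia.
(* The transversal entry 2b - a = a + 2g = b + g moves to the new column of row a and the new row of
   column b, and [None] replaces it. As g is nonzero, the diagonal stays untouched. *)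
pose op (a b : option 'I_(j.*2).+1) :=
  match a, b with
  | Some a, Some b => if b == (a + g)%R then None else Some (b + b - a)%R
  | Some a, None => Some (a + g + g)%R
  | None, Some b => Some (b + g)%R
  | None, None => None
  end.
exists (option 'I_(j.*2).+1), op; split.
- by rewrite card_option card_ord.
- case=> //= a; rewrite -[X in X == _]addr0 (inj_eq (addrI a)) eq_sym (negbTE g0).
  by rewrite addrK.
(* Off the transversal the displaced entry does not recur in its row, since doubling is
   injective. *)
- have aux a b : (b != a + g)%R -> (a + g + g)%R != (b + b - a)%R.
    apply: contra => /eqP e; apply/eqP/(@odd_dblI j).
    by rewrite /= -[LHS](subrK a) -e -addrA [(g + a)%R]addrC.
  case=> [a|] [b|] [c|] //=.
  + case: eqP => [->|_]; case: eqP => [->|_] // /Some_inj e.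
    by congr Some; apply: (@odd_dblI j); apply: addIr e.
  + by case: eqP => // /eqP/aux /eqP ne /Some_inj/esym.
  + by case: eqP => // /eqP/aux /eqP ne /Some_inj.
  + by move/Some_inj/addIr ->.
- have aux a b : (b != a + g)%R -> (b + g)%R != (b + b - a)%R.
    rewrite -addrA (inj_eq (addrI b)); apply: contra => /eqP ->.
    by rewrite addrCA subrr addr0.
  case=> [b|] [a|] [c|] //=.
  + case: eqP => [eb|_]; case: eqP => [e|_] //.
      by move=> _; congr Some; apply: (@addIr _ g); rewrite -eb.
    by move=> /Some_inj/addrI/oppr_inj ->.
  + by case: eqP => // /eqP/aux /eqP ne /Some_inj/esym.
  + by case: eqP => // /eqP/aux /eqP ne /Some_inj.
  + by move/Some_inj/addIr/addIr ->.
Qed.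

Lemma gdd_10k6 k : k != 2 ->
  exists (T : finType) (P : {set {set T}}) (C : seq {set T}),
  is_GDD (10 * k + 6) 2 6 (2 * (10 * k + 6)) (10 * k + 6 - 1) P C /\
  has_configuration 1 5 P C.
Proof.
case/idempotent_quasigroup=> Q [op [<- op_idem op_injr op_injl]].
exact: (gdd_of_half_system (@half_pointP Q) (@odd_dblI _) op_idem op_injr op_injl).
Qed.

(** * The exceptional order n = 26 *)

Definition difference_family : seq (seq nat) :=
  [:: [:: 0; 1; 5; 11; 13]; [:: 0; 6; 7; 17; 19]; [:: 0; 1; 5; 7; 10];
      [:: 0; 6; 8; 9; 23]; [:: 0; 4; 8; 11; 16]].

(* Representatives modulo translation of the blocks in which c + t goes with the
   single points of the same parity as t on one side, and of the opposite parity
   on the other. *)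
Definition cyclic_patterns : seq (seq (bool * nat)) :=
  [seq block g 0 [seq (z + ct.2.*2 + g) %% 26 | z <- ct.1]
  | g <- [:: false; true],
    ct <- [seq (c, t) | c <- difference_family, t <- iota 0 13]].

Definition orbit_incidence (g h : bool) (d : nat) : nat :=
  sumn [seq incidence cyclic_patterns (g, s) (h, (s + d) %% 26) | s <- iota 0 26].

(** Each nonzero residue is a difference of the base blocks 4 times, and the 13 values of t give 52.
    For mixed pairs, elements of one parity among the 25 count through one side and those of the
    other parity through the other side. *)
Lemma cyclic_table :
  all (fun g => all (fun d =>
      ((d != 0) ==> (orbit_incidence g g d == 52)) &&
      (orbit_incidence g (~~ g) d == 25)) (iota 0 26)) [:: false; true].
Proof. by vm_compute. Qed.

Lemma cyclic_patterns_good :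
  all (fun b => one_five b && all (fun p => p.2 < 26) b) cyclic_patterns.
Proof. by vm_compute. Qed.

#[global] Opaque cyclic_patterns.

Definition translate (x : 'I_26) (p : bool * nat) : bool * 'I_26 :=
  (p.1, inord p.2 + x)%R.

Definition cyclic_blocks : seq (seq (bool * 'I_26)) :=
  [seq map (translate x) b | x <- enum 'I_26, b <- cyclic_patterns].

Lemma count_translate x (b : seq (bool * nat)) g (u : 'I_26) :
  all (fun p => p.2 < 26) b ->
  count_mem (g, u) (map (translate x) b) = count_mem (g, val (u - x)%R) b.
Proof.
move=> /allP lt_b; rewrite count_map; apply: eq_in_count => -[h z] /lt_b /= z26.
rewrite /translate !xpair_eqE; congr (_ && _).
by rewrite (can2_eq (addrK x) (subrK x)) -(inj_eq val_inj) /= inordK.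
Qed.

Lemma incidence_cyclic g h (u w : 'I_26) :
  incidence cyclic_blocks (g, u) (h, w) = orbit_incidence g h (val (w - u)%R).
Proof.
rewrite incidenceE big_allpairs_dep big_enum /=.
transitivity (\sum_x
  incidence cyclic_patterns (g, val (u - x)%R) (h, val (w - x)%R)).
  apply: eq_bigr => x _; rewrite incidenceE !big_seq; apply: eq_bigr => b bL.
  have /allP/(_ b bL)/andP[_ lt_b] := cyclic_patterns_good.
  by rewrite !count_translate.
rewrite /orbit_incidence sumnE big_map -[iota _ _]/(index_iota 0 26) big_mkord.
(* Substituting s = u - x turns the sum over translates into one over s, with w - x = s + (w -
   u). *)
rewrite (reindex_inj (inv_inj (subKr u))); apply: eq_bigr => s _.
have addE (a b : 'I_26) : val (a + b)%R = (a + b) %% 26 by [].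
rewrite subKr; have -> : (w - (u - s) = s + (w - u))%R by rewrite opprB addrCA.
by rewrite addE.
Qed.

Lemma gdd_26 :
  exists (T : finType) (P : {set {set T}}) (C : seq {set T}),
  is_GDD 26 2 6 (2 * 26) (26 - 1) P C /\ has_configuration 1 5 P C.
Proof.
have tab g (d : 'I_26) :
    (d != 0%R -> orbit_incidence g g (val d) = 52) *
    (orbit_incidence g (~~ g) (val d) = 25).
  have /allP/(_ g) := cyclic_table; rewrite !inE; case: g => /(_ isT);
    move=> /allP/(_ (val d)); rewrite mem_iota ltn_ord => /(_ isT);
    by case/andP=> /implyP e1 /eqP e2; split=> // d0; apply/eqP/e1.
rewrite -(card_ord 26); apply: (@gdd_of_incidence _ cyclic_blocks).
- by rewrite card_ord.
- apply/allP => _ /allpairsP[[x b] /= [_ bL ->]].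
  have /allP/(_ b bL)/andP[/and3P[ub sb cb] /allP lt_b] := cyclic_patterns_good.
  apply/and3P; split; rewrite ?size_map ?count_map //.
  rewrite map_inj_in_uniq // => -[g z] [g' z'] /lt_b /= z26 /lt_b /= z26'.
  move=> e; have gg' : g = g' := congr1 fst e.
  have /addIr/(congr1 val) : (inord z + x = inord z' + x)%R := congr1 snd e.
  by rewrite /= !inordK // gg' => ->.
- move=> g z z' zz'; rewrite incidence_cyclic card_ord tab //.
  by rewrite subr_eq0 eq_sym.
- by move=> z z'; rewrite incidence_cyclic card_ord (tab false).
Qed.

Theorem theorem7p4 (n : nat) (n_gt0 : 0 < n) (n_mod : n = 6 %[mod 10]) :
  exists (T : finType) (P : {set {set T}}) (B : seq {set T}),
    is_GDD n 2 6 (2 * n) (n - 1) P B /\ has_configuration 1 5 P B.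
Proof.
have -> : n = 10 * (n %/ 10) + 6.
  by rewrite {1}(divn_eq n 10) n_mod mulnC.
(* The quotient is the number k of sign classes; k = 2, where there is no idempotent quasigroup, is
   n = 26. *)
by have [->|] := eqVneq (n %/ 10) 2; [apply: gdd_26 | apply: gdd_10k6].
Qed.
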